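(* Let $n \geq 9$ and $m \geq n$ be integers. Then the product $(m+1)(m+2)\cdots(m+n)$ of $n$ consecutive integers strictly greater than $n$ is divisible by at least three distinct primes strictly greater than $n$. *)

(* Defs.v *)
From mathcomp Require Export all_boot.

(* Main.v *)
From Stdlib Require Import NArith ZArith Lia.
Require Import Defs.
From mathcomp Require Import all_boot.
From mathcomp Require Import zify.

(* Let N = m + n, and suppose that at most two primes larger than n divide
   (m+1)...(m+n) = n! C(N,n). Every prime power in C(N,n) is at most N, so
   (m+1)^n <= n! N^(pi(n)+2); with 3 pi(n) <= n + 5 this bounds m: m < 172 for
   n < 31, m + 1 < 8n for n < 160, and 4 (m+1)^2 < n^3 beyond. For n < 4096
   finitely many m remain: a direct search settles n < 31, and prime gaps put
   three primes in (m, m+n] otherwise.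
   For n >= 4096 one uses Erdos' refinement. With s = floor(sqrt N), a prime
   p > s divides C(N,n) at most once, and not at all when p <= n and N < 3p, so
   C(N,n) <= N^(2 + pi(s)) 4^min(n, N/3). Since 2n C(N,n) is at least
   (3/2)^n 4^min(n, N/3), this gives (27/8)^n <= N^(s+14), which contradicts
   4 (m+1)^2 < n^3. *)

Set Implicit Arguments.
Unset Strict Implicit.
Unset Printing Implicit Defensive.

(** * Exponents of primes in binomial coefficients *)

(** Legendre's formula with a cutoff [N] shared by several factorials, so that their sums compare
    term by term. *)
Lemma logn_fact_leq p n N :
  prime p -> n <= N -> logn p n`! = \sum_(1 <= k < N.+1) n %/ p ^ k.
Proof.
move=> pr_p le_nN; rewrite logn_fact //.
have -> : \sum_(1 <= k < N.+1) n %/ p ^ k =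
    \sum_(1 <= k < n.+1) n %/ p ^ k + \sum_(n.+1 <= k < N.+1) n %/ p ^ k.
  by rewrite -big_cat_nat.
rewrite [X in _ = _ + X]big_nat_cond [X in _ = _ + X]big1 ?addn0 // => k.
rewrite andbT => /andP[lt_nk _]; rewrite divn_small //.
by apply: (leq_trans lt_nk); rewrite ltnW // ltn_expl // prime_gt1.
Qed.

Lemma logn_bin_fact p m n : prime p ->
  logn p (m + n)`! = logn p 'C(m + n, n) + (logn p n`! + logn p m`!).
Proof.
move=> pr_p; rewrite -(@bin_fact (m + n) n) ?leq_addl // addnK.
by rewrite !lognM ?muln_gt0 ?fact_gt0 ?bin_gt0 ?leq_addl.
Qed.

(** By Legendre's formula each [k] adds a carry of 0 or 1 to the exponent, and nothing once
    [p ^ k > m + n]. *)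
Lemma bin_prime_power_le p m n : prime p -> 0 < m + n ->
  p ^ logn p 'C(m + n, n) <= m + n.
Proof.
move=> pr_p N_gt0; have p_gt1 := prime_gt1 pr_p.
apply: leq_trans (trunc_logP p_gt1 N_gt0); rewrite leq_exp2l //.
set t := trunc_log p (m + n).
have := logn_bin_fact m n pr_p.
rewrite !(@logn_fact_leq p _ (m + n)) ?leq_addl ?leq_addr // => E.
have: \sum_(1 <= k < (m + n).+1) (m + n) %/ p ^ k <=
      \sum_(1 <= k < (m + n).+1) ((k <= t) + (n %/ p ^ k + m %/ p ^ k)).
  apply: leq_sum => k _.
  have pk_gt0 : 0 < p ^ k by rewrite expn_gt0 prime_gt0.
  have [le_kt|lt_tk] := leqP k t.
    by rewrite divnD // [n %/ _ + _]addnC addnC leq_add2r leq_b1.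
  rewrite divn_small //; apply: leq_trans (trunc_log_ltn (m + n) p_gt1) _.
  by rewrite leq_exp2l.
rewrite big_split /= big_split /= E leq_add2r => /leq_trans; apply.
rewrite -big_mkcond /= (eq_bigl (fun k => k < t.+1)) // sum1_count.
rewrite -size_filter.
have /uniq_leq_size: uniq [seq i <- index_iota 1 (m + n).+1 | i < t.+1].
  by rewrite filter_uniq ?iota_uniq.
move/(_ (iota 1 t)); rewrite size_iota; apply=> k.
by rewrite mem_filter mem_index_iota mem_iota add1n => /andP[-> /andP[->]].
Qed.

Lemma logn_bin_le1 p m n : prime p -> 0 < m + n -> m + n < p * p ->
  logn p 'C(m + n, n) <= 1.
Proof.
move=> pr_p N_gt0 lt_Npp; have := bin_prime_power_le pr_p N_gt0.
by move/leq_ltn_trans/(_ lt_Npp); rewrite mulnn ltn_exp2l // prime_gt1.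
Qed.

(* Here N %/ p = 2 and n %/ p = m %/ p = 1, and higher powers of p do not count. *)
Lemma logn_bin_eq0 p m n : prime p -> n <= m -> p <= n -> m + n < 3 * p ->
  m + n < p * p -> logn p 'C(m + n, n) = 0.
Proof.
move=> pr_p le_nm le_pn lt_N3p lt_Npp; have p_gt0 := prime_gt0 pr_p.
have N_gt0 : 0 < m + n by lia.
have lead a : a <= m + n -> 0 < a -> logn p a`! = a %/ p.
  move=> le_aN a_gt0; rewrite logn_fact // big_ltn // expn1.
  rewrite big_nat_cond big1 ?addn0 // => k /andP[/andP[k_gt1 _] _].
  rewrite divn_small //; apply: leq_ltn_trans le_aN _.
  by apply: leq_trans lt_Npp _; rewrite mulnn leq_exp2l // prime_gt1.
have := logn_bin_fact m n pr_p; rewrite !lead ?leq_addl ?leq_addr //; try lia.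
have := leq_trunc_div (m + n) p; have := leq_div2r p le_pn.
have := leq_div2r p (leq_trans le_pn le_nm); rewrite divnn p_gt0 /=.
set a := (m + n) %/ p => *.
have : a < 3 by rewrite ltn_divLR.
lia.
Qed.

(** * Upper bounds for the number and the product of the primes up to [x] *)

Definition prime_pi x := count prime (iota 1 x).

Lemma prime_piS x : prime_pi x.+1 = prime_pi x + prime x.+1.
Proof. by rewrite /prime_pi -[in LHS](addn1 x) iotaD count_cat /= addn0 add1n. Qed.

(* Beyond 3, primes lie in two residue classes modulo 6. *)
Lemma prime_pi_leq x : 3 * prime_pi x <= x + 5.
Proof.
have step6 y : 2 < y -> prime_pi (y + 6) <= (prime_pi y).+2.
  move=> y_gt2; rewrite !addnS addn0 !prime_piS.
  have np z : 2 < y + z -> (2 %| y + z) || (3 %| y + z) -> 3 < y + z -> prime (y + z) = false.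
    move=> gt2 d gt3; apply/negP => pr; case/orP: d; rewrite dvdn_prime2 //; lia.
  have := np 1; have := np 2; have := np 3; have := np 4; have := np 5; have := np 6.
  rewrite !addnS addn0.
  have: y %% 6 < 6 by rewrite ltn_mod.
  lia.
(* [step6] at [x - 6] needs [2 < x - 6], so the values below 9 are computed. *)
have base: all (fun x => 3 * prime_pi x <= x + 5) (iota 0 9) by [].
elim/ltn_ind: x => x IH.
have [lt_x9|le_9x] := ltnP x 9; first by apply: (allP base); rewrite mem_iota.
have := IH (x - 6); have := step6 (x - 6); rewrite subnK; lia.
Qed.

Definition primorial x := \prod_(1 <= p < x.+1 | prime p) p.

Lemma prod_primes_dvd (s : seq nat) a :
  uniq s -> {in s, forall p, prime p && (p %| a)} -> \prod_(p <- s) p %| a.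
Proof.
elim: s => [|p s IH] /=; first by rewrite big_nil dvd1n.
case/andP=> p_notin uniq_s dvd_s; rewrite big_cons.
have /andP[pr_p p_a] := dvd_s p (mem_head p s).
rewrite Gauss_dvd; first by rewrite p_a IH // => q qs; rewrite dvd_s // inE qs orbT.
rewrite prime_coprime // Euclid_dvd_prod // big_has_cond.
apply/negP => /hasP[q qs /= pq]; move: p_notin; rewrite dvdn_prime2 // in pq.
  by rewrite (eqP pq) qs.
by case/andP: (dvd_s q (mem_behead (s := p :: s) qs)).
Qed.

(** Two Pascal steps give ['C(2k+3, k+1) <= 2 'C(2k+2, k+1) = 4 'C(2k+1, k)], by growth toward the
    middle and by symmetry. *)
Lemma bin_odd_leq k : 'C(k.*2.+1, k) <= 4 ^ k.
Proof.
elim: k => [|k IH] //.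
have E := mul_bin_left k.*2.+2 k.
have le : 'C(k.*2.+2, k) <= 'C(k.*2.+2, k.+1).
  rewrite -(leq_pmul2l (ltn0Sn k)) E leq_mul2r; apply/orP; right; lia.
have sym : 'C(k.*2.+1, k.+1) = 'C(k.*2.+1, k).
  rewrite -bin_sub; last by lia.
  by congr 'C(_, _); lia.
rewrite doubleS binS expnS; move: le; rewrite (binS _ k) sym; lia.
Qed.

(** An even [x > 2] is not prime. For [x = 2k+1], all primes from [k+2] to [2k+1] divide
    ['C(2k+1, k) <= 4 ^ k], and induction covers those up to [k+1]. *)
Lemma primorial_leq x : primorial x <= 4 ^ x.
Proof.
elim/ltn_ind: x => x IH.
have [le_x2|lt_2x] := leqP x 2.
  by case: x le_x2 {IH} => [|[|[|]]] // _; rewrite /primorial unlock.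
have [x_odd|x_even] := boolP (odd x); last first.
  have np : prime x = false.
    by apply/negP => /even_prime[]; [lia | apply/negP].
  case: x lt_2x IH {x_even} np => // x lt_2x IH np.
  rewrite /primorial big_mkcond big_nat_recr //= np muln1 -big_mkcond /=.
  by apply: leq_trans (IH x _) _; rewrite ?leq_exp2l.
have [k Ex] : exists k, x = k.*2.+1 by exists x./2; lia.
rewrite /primorial (@big_cat_nat _ _ _ k.+2) //=; last by lia.
have -> : 4 ^ x = 4 ^ k.+1 * 4 ^ k by rewrite -expnD; congr (_ ^ _); lia.
apply: leq_mul; first by apply: IH; lia.
apply: leq_trans (bin_odd_leq k); apply: dvdn_leq; first by rewrite bin_gt0; lia.
rewrite -big_filter; apply: prod_primes_dvd.
  by rewrite filter_uniq // iota_uniq.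
move=> p; rewrite mem_filter mem_index_iota => /and3P[pr_p gt_p lt_p].
rewrite pr_p /=.
have le_kx : k <= k.*2.+1 by lia.
have : p %| (k.*2.+1)`! by rewrite dvdn_fact //; lia.
rewrite -(bin_fact le_kx) !Euclid_dvdM //.
have ndvd a : a < p -> (p %| a`!) = false.
  move=> lt_ap; apply/negP; rewrite fact_prod Euclid_dvd_prod // big_has_cond.
  case/hasP=> i; rewrite mem_index_iota => /andP[i_gt0 i_le] /= /dvdn_leq; lia.
by rewrite !ndvd ?orbF //; lia.
Qed.

(** * Lower bounds for binomial coefficients *)

(** Since [(k+1) 'C(2k+2, k+1) = 2 (2k+1) 'C(2k, k)], the right side grows by [4 (2k+1) / (2k)], at
    least 4. *)
Lemma central_bin_geq n : 0 < n -> 4 ^ n <= 2 * n * 'C(n.*2, n).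
Proof.
elim: n => [|[|n] IH] // _.
have {}IH := IH (ltn0Sn _); set k := n.+1 in IH *.
have E1 := mul_bin_diag k.*2.+2 k; have E2 := mul_bin_down k.*2.+1 k.
rewrite /= in E1 E2; rewrite doubleS expnS.
have -> : 2 * k.+1 * 'C(k.*2.+2, k.+1) = 4 * (k.*2.+1 * 'C(k.*2, k)).
  rewrite E2 -mulnA -E1; have -> : k.*2.+1 - k = k.+1 by lia.
  lia.
rewrite leq_mul2l /=; apply: leq_trans IH _; rewrite leq_mul2r; lia.
Qed.

(** Raising the top entry from [M] to [M+1] multiplies by [(M+1) / (M+1-n)], at least 3/2 while
    [M+1 <= 3n]. *)
Lemma bin_growth n j : j <= n -> 3 ^ j * 'C(n.*2, n) <= 2 ^ j * 'C(n.*2 + j, n).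
Proof.
elim: j => [|j IH] lt_jn; first by rewrite addn0.
have E := mul_bin_down (n.*2 + j).+1 n; rewrite /= in E.
have {}IH := IH (ltnW lt_jn).
have step : 3 * 'C(n.*2 + j, n) <= 2 * 'C((n.*2 + j).+1, n).
  have gt0 : 0 < (n.*2 + j).+1 - n by lia.
  rewrite -(leq_pmul2l gt0) [X in _ <= X]mulnCA -E.
  rewrite !mulnA leq_mul2r; apply/orP; right; lia.
rewrite addnS !expnS -mulnA; apply: leq_trans (_ : 3 * (2 ^ j * 'C(n.*2 + j, n)) <= _).
  by rewrite leq_mul2l.
by rewrite mulnCA -mulnA [X in _ <= X]mulnCA leq_mul2l step orbT.
Qed.

(** The cube of [(3/2)^n 4^(N/3) <= 2n 'C(N, n)] for [N = 2n+j]; cubing avoids the fraction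
    [N/3]. *)
Lemma bin_double_cube_geq n j : 0 < n -> j <= n ->
  27 ^ n * 4 ^ (n.*2 + j) <= (2 * n * 'C(n.*2 + j, n)) ^ 3 * 8 ^ n.
Proof.
move=> n_gt0 le_jn.
have H1 := central_bin_geq n_gt0; have H2 := bin_growth le_jn.
have H : 3 ^ j * 4 ^ n <= 2 ^ j * (2 * n * 'C(n.*2 + j, n)).
  apply: leq_trans (_ : 3 ^ j * (2 * n * 'C(n.*2, n)) <= _).
    by rewrite leq_mul2l H1 orbT.
  by rewrite mulnCA [X in _ <= X]mulnCA leq_mul2l H2 orbT.
have := leq_exp2r (3 ^ j * 4 ^ n) (2 ^ j * (2 * n * 'C(n.*2 + j, n))) (isT : 0 < 3).
rewrite H; set X := 2 * n * _; rewrite [(2 ^ j * X) ^ 3]expnMn.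
rewrite expnMn -!expnM ![_ * 3]mulnC !expnM -[3 ^ 3]/27 -[4 ^ 3]/64 -[2 ^ 3]/8 => {H1 H2}H3.
have gt0 : 0 < 8 ^ j by rewrite expn_gt0.
rewrite -(leq_pmul2l gt0) mulnA [X in _ <= X]mulnA.
apply: leq_trans (leq_mul H3 (leqnn (8 ^ n))).
(* Both sides share [27 ^ j * 16 ^ n * 32 ^ j], which leaves [27 ^ (n - j) <= 32 ^ (n - j)]. *)
have -> : 8 ^ j * 27 ^ n * 4 ^ (n.*2 + j) = 27 ^ j * 16 ^ n * (27 ^ (n - j) * 32 ^ j).
  rewrite -{1}(subnK le_jn) !expnD -mul2n [4 ^ (2 * n)]expnM -[4 ^ 2]/16.
  rewrite (expnMn 8 4 j : 32 ^ j = _); lia.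
have -> : 27 ^ j * 64 ^ n * 8 ^ n = 27 ^ j * 16 ^ n * (32 ^ (n - j) * 32 ^ j).
  rewrite -expnD subnK // (expnMn 16 4 n : 64 ^ n = _) (expnMn 4 8 n : 32 ^ n = _); lia.
rewrite leq_mul2l leq_mul2r; apply/orP; right; apply/orP; right.
by case: (n - j) => // d; rewrite leq_exp2r.
Qed.

(** * Consequences of having at most two primes above [n] *)

Definition rising m n := \prod_(1 <= i < n.+1) (m + i).

Definition large_primes m n := [seq p <- primes (rising m n) | n < p].

Lemma rising_bin m n : rising m n = 'C(m + n, n) * n`!.
Proof.
apply/eqP; rewrite -(eqn_pmul2r (fact_gt0 m)) -mulnA.
have -> : 'C(m + n, n) * (n`! * m`!) = (m + n)`!.
  by rewrite -(@bin_fact (m + n) n) ?leq_addl // addnK.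
apply/eqP; rewrite /rising; elim: n => [|n IH].
  by rewrite big_geq // mul1n addn0.
by rewrite big_nat_recr //= addnS factS -IH; lia.
Qed.

Lemma rising_gt0 m n : 0 < rising m n.
Proof. by rewrite rising_bin muln_gt0 fact_gt0 bin_gt0 leq_addl. Qed.

Lemma prod_primes_logn a : 0 < a -> a = \prod_(p <- primes a) p ^ logn p a.
Proof. by move=> a_gt0; rewrite {1}(prod_prime_decomp a_gt0) prime_decompE big_map. Qed.

Lemma prod_leq_exp (s : seq nat) (F : nat -> nat) N :
  {in s, forall p, F p <= N} -> \prod_(p <- s) F p <= N ^ size s.
Proof.
elim: s => [|p s IH] le_FN; first by rewrite big_nil.
rewrite big_cons expnS leq_mul ?le_FN ?mem_head // IH // => q qs.
by rewrite le_FN // inE qs orbT.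
Qed.

(** At most two primes exceed [n] and at most [prime_pi s] are up to [s], each with prime power at
    most [m + n]. The others occur once and are at most [y], so their product divides [primorial y].
    In [mid], the boolean [p <= y] serves as the exponent bound 0 or 1. *)
Lemma bin_leq_few_large m n s y : 0 < n ->
  size (large_primes m n) <= 2 ->
  (forall p, prime p -> p <= n -> s < p -> 
     logn p 'C(m + n, n) <= (p <= y)) ->
  'C(m + n, n) <= (m + n) ^ (2 + prime_pi s) * primorial y.
Proof.
move=> n_gt0 few mid; set c := 'C(m + n, n) in mid *; have N_gt0 : 0 < m + n by lia.
have c_gt0 : 0 < c by rewrite bin_gt0 leq_addl.
rewrite [X in X <= _](prod_primes_logn c_gt0) (bigID (fun p => n < p)) /=.
rewrite [X in _ * X](bigID (fun p => p <= s)) /= mulnA expnD.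
have Nexp (r : pred nat) :
    \prod_(p <- primes c | r p) p ^ logn p c <= (m + n) ^ size (filter r (primes c)).
  rewrite -big_filter prod_leq_exp // => p; rewrite mem_filter mem_primes.
  by case/and3P=> _ pr_p _; apply: bin_prime_power_le.
apply: leq_mul; [apply: leq_mul|].
- apply: leq_trans (Nexp _) _; rewrite leq_pexp2l //; apply: leq_trans few.
  apply: uniq_leq_size; first by rewrite filter_uniq ?primes_uniq.
  move=> p; rewrite /large_primes !mem_filter !mem_primes c_gt0 rising_gt0 /=.
  by case/and3P=> -> -> p_c; rewrite rising_bin dvdn_mulr.
- apply: leq_trans (Nexp _) _; rewrite leq_pexp2l // /prime_pi -size_filter.
  apply: uniq_leq_size; first by rewrite filter_uniq ?primes_uniq.
  move=> p; rewrite !mem_filter mem_primes mem_iota.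
  by case/and3P => /andP[_ le_ps] pr_p _; rewrite pr_p prime_gt0 //= add1n ltnS.
- rewrite -big_filter; set l := filter _ _.
  have l_mem p : p \in l -> [/\ prime p, logn p c = 1 & p <= y].
    rewrite mem_filter -leqNgt -ltnNge => /andP[/andP[le_pn lt_sp] p_c].
    have gt0 := p_c; rewrite -logn_gt0 in gt0.
    rewrite mem_primes in p_c; have /and3P[pr_p _ _] := p_c.
    have := mid _ pr_p le_pn lt_sp.
    by case: (p <= y) => /= ?; split => //; lia.
  rewrite big_seq (eq_bigr id) => [|p /l_mem[_ -> _]]; last by rewrite expn1.
  rewrite -big_seq; apply: dvdn_leq.
    by rewrite prodn_cond_gt0 // => p /prime_gt0.
  apply: prod_primes_dvd; first by rewrite filter_uniq ?primes_uniq.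
  move=> p /l_mem[pr_p _ le_py]; rewrite pr_p /=.
  have pI : p \in index_iota 1 y.+1 by rewrite mem_index_iota prime_gt0.
  by rewrite /primorial (big_rem p) //= pr_p dvdn_mulr.
Qed.

Lemma few_large_pow_leq m n : 0 < n -> size (large_primes m n) <= 2 ->
  (m.+1) ^ n <= n`! * (m + n) ^ ((n + 11) %/ 3).
Proof.
move=> n_gt0 few.
have le1 : (m.+1) ^ n <= rising m n.
  rewrite /rising; elim: (n) => [|k IH]; first by rewrite big_geq.
  rewrite big_nat_recr //= expnSr leq_mul //; lia.
apply: leq_trans le1 _; rewrite rising_bin mulnC leq_mul2l; apply/orP; right.
(* With [s = n] no prime lies between [s] and [n], and [y = 0] makes the primorial 1. *)
have := @bin_leq_few_large m n n 0 n_gt0 few; rewrite /primorial big_geq // muln1 => H.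
apply: leq_trans (H _) _; first by move=> p _ le_pn lt_np; lia.
rewrite leq_pexp2l //; first by lia.
by have := prime_pi_leq n; lia.
Qed.

Lemma few_large_pow_leq_cube m n : 0 < n -> size (large_primes m n) <= 2 ->
  (m.+1) ^ (3 * n) <= n`! ^ 3 * (m + n) ^ (n + 11).
Proof.
move=> n_gt0 few; have H := few_large_pow_leq n_gt0 few.
rewrite mulnC expnM; apply: leq_trans (_ : (n`! * (m + n) ^ ((n + 11) %/ 3)) ^ 3 <= _).
  by rewrite leq_exp2r.
rewrite expnMn leq_mul2l -expnM leq_pexp2l ?orbT //; first by lia.
exact: leq_trunc_div.
Qed.

(** A prime [p > s] has [p * p > m + n], hence exponent at most 1. If moreover [y < p <= n], then
    [3p > m + n] and the exponent is 0. *)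
Lemma few_large_bin_cube_leq m n s : 0 < n -> n <= m -> m + n < s.+1 * s.+1 ->
  size (large_primes m n) <= 2 ->
  'C(m + n, n) ^ 3 <= (m + n) ^ (s + 11) * 4 ^ (minn (3 * n) (m + n)).
Proof.
move=> n_gt0 le_nm lt_N few; set y := minn n ((m + n) %/ 3).
have H : 'C(m + n, n) <= (m + n) ^ (2 + prime_pi s) * 4 ^ y.
  apply: leq_trans (_ : _ <= (m + n) ^ (2 + prime_pi s) * primorial y) _; last first.
    by rewrite leq_mul2l primorial_leq orbT.
  apply: bin_leq_few_large => // p pr_p le_pn lt_sp.
  have lt_Npp : m + n < p * p by apply: leq_trans lt_N _; rewrite leq_mul.
  have [le_py|lt_yp] := leqP p y; first by apply: logn_bin_le1 => //; lia.
  by rewrite logn_bin_eq0 //; lia.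
apply: leq_trans (_ : ((m + n) ^ (2 + prime_pi s) * 4 ^ y) ^ 3 <= _).
  by rewrite leq_exp2r.
rewrite expnMn -!expnM leq_mul //; last by rewrite leq_pexp2l //; lia.
rewrite leq_pexp2l //; first by lia.
by have := prime_pi_leq s; lia.
Qed.

(** Once [m + n] exceeds [3n] the minimum stays at [3n], and monotonicity in the top entry reduces
    to ['C(3n, n)]. *)
Lemma bin_cube_geq m n : 0 < n -> n <= m ->
  27 ^ n * 4 ^ (minn (3 * n) (m + n)) <= (2 * n * 'C(m + n, n)) ^ 3 * 8 ^ n.
Proof.
move=> n_gt0 le_nm; have [le_N|lt_N] := leqP (m + n) (3 * n).
  have := @bin_double_cube_geq n (m - n) n_gt0.
  have -> : n.*2 + (m - n) = m + n by lia.
  by apply; lia.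
have := @bin_double_cube_geq n n n_gt0 (leqnn n).
have -> : n.*2 + n = 3 * n by lia.
move/leq_trans; apply; rewrite leq_mul2r leq_exp2r // leq_mul2l; apply/orP; right; apply/orP; right.
by apply: leq_bin2l; lia.
Qed.

(** The power of 4 cancels between the two cubed bounds; [(2n)^3 <= (m+n)^3] turns the 11 in the
    exponent into 14. *)
Lemma few_large_pow27_leq m n s : 0 < n -> n <= m -> m + n < s.+1 * s.+1 ->
  size (large_primes m n) <= 2 ->
  27 ^ n <= 8 ^ n * (m + n) ^ (s + 14).
Proof.
move=> n_gt0 le_nm lt_N few.
have U := few_large_bin_cube_leq n_gt0 le_nm lt_N few; have L := bin_cube_geq n_gt0 le_nm.
have gt0 : 0 < 4 ^ (minn (3 * n) (m + n)) by rewrite expn_gt0.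
rewrite -(leq_pmul2r gt0); apply: leq_trans L _.
rewrite [_ ^ 3]expnMn [s + 14](_ : _ = 3 + (s + 11)); last by lia.
rewrite [(m + n) ^ (3 + _)]expnD.
have le3 : (2 * n) ^ 3 <= (m + n) ^ 3 by rewrite leq_exp2r //; lia.
have := leq_mul (leq_mul le3 U) (leqnn (8 ^ n)).
move: ((2 * n) ^ 3) ((m + n) ^ 3) ('C(m + n, n) ^ 3) ((m + n) ^ (s + 11)) => a b c d.
by rewrite !mulnA [b * d * _ * _]mulnC !mulnA.
Qed.

(** * Bounds on [m] in terms of [n] *)

(** Bernoulli's inequality [1 + k/n <= (1 + 1/n)^k] with denominators cleared. *)
Lemma bernoulli_leq n k : n ^ k * (n + k) <= n * n.+1 ^ k.
Proof.
elim: k => [|k IH]; first by rewrite !expn0; lia.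
rewrite [n.+1 ^ _]expnSr mulnA; apply: leq_trans (leq_mul IH (leqnn _)).
rewrite expnSr -!mulnA leq_mul2l; apply/orP; right; nia.
Qed.

(** Bernoulli gives [2 n^n <= (n+1)^n] for the induction, which starts at 6 with
    [46080 <= 46656]. *)
Lemma fact_leq_half n : 5 < n -> 2 ^ n * n`! <= n ^ n.
Proof.
elim: n => // n IH; rewrite ltnS leq_eqVlt => /predU1P[<-|lt_5n].
  by rewrite !factS fact0; lia.
have {}IH := IH lt_5n; rewrite factS !expnS.
have le2 : 2 * n ^ n <= n.+1 ^ n.
  have n_gt0 : 0 < n by lia.
  by have := bernoulli_leq n n; rewrite -(leq_pmul2l n_gt0); nia.
by apply: leq_trans (_ : n.+1 * (2 * n ^ n) <= _); [nia | rewrite leq_mul2l le2 orbT].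
Qed.

(** In the cubed bound, [n!] is replaced by [(n/2)^n] and [m+n] by [(d/c) (m+1)]; then
    [(m+1)^(n+11)] cancels. *)
Lemma few_large_reduced m n c d : 5 < n -> size (large_primes m n) <= 2 ->
  c * (m + n) <= d * m.+1 ->
  8 ^ n * c ^ (n + 11) * m.+1 ^ (2 * n - 11) <= n ^ (3 * n) * d ^ (n + 11).
Proof.
move=> n_gt5 few le_cd; have n_gt0 : 0 < n by lia.
have H := few_large_pow_leq_cube n_gt0 few.
have gt0 : 0 < m.+1 ^ (n + 11) by rewrite expn_gt0.
have F : 8 ^ n * n`! ^ 3 <= n ^ (3 * n).
  have := fact_leq_half n_gt5; rewrite -(leq_exp2r _ _ (isT : 0 < 3)).
  by rewrite expnMn -!expnM ![_ * 3]mulnC !expnM.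
have P : (c * (m + n)) ^ (n + 11) <= (d * m.+1) ^ (n + 11).
  by rewrite leq_exp2r //; lia.
rewrite !expnMn in P.
rewrite -(leq_pmul2r gt0) -mulnA -expnD [2 * n - 11 + _](_ : _ = 3 * n); last by lia.
apply: leq_trans (leq_mul (leqnn (8 ^ n * c ^ (n + 11))) H) _.
rewrite mulnACA -[X in _ <= X]mulnA; exact: leq_mul.
Qed.

Lemma ratio_power_leq c d a b e x y : 0 < a -> a * y <= b * x ->
  c * b ^ e <= d * a ^ e -> c * y ^ e <= d * x ^ e.
Proof.
move=> a_gt0 le_yx le_cd; have ae_gt0 : 0 < a ^ e by rewrite expn_gt0 a_gt0.
rewrite -(leq_pmul2l ae_gt0) mulnCA -expnMn.
have : (a * y) ^ e <= (b * x) ^ e by case: (e) => // e'; rewrite leq_exp2r.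
rewrite [(b * x) ^ e]expnMn => le_pow.
apply: leq_trans (leq_mul (leqnn c) le_pow) _.
by rewrite mulnA [X in _ <= X]mulnA [a ^ e * d]mulnC leq_mul2r le_cd orbT.
Qed.

(** For [k >= 160], [((k+1)/k)^33] is at most [(161/160)^33], below [25/9 = 100/36]. *)
Lemma pow33_ltn n : 160 <= n -> n ^ 33 * 36 ^ (n + 11) < 100 ^ (n + 11).
Proof.
elim: n => // k IH; rewrite leq_eqVlt => /predU1P[<-|lt_k]; first by lia.
have {}IH := IH lt_k.
have step : 9 * k.+1 ^ 33 <= 25 * k ^ 33.
  apply: (@ratio_power_leq 9 25 160 161); [lia | lia | lia].
rewrite addSn [36 ^ _]expnSr [100 ^ _]expnSr; move: step IH {lt_k}.
move: (k.+1 ^ 33) (k ^ 33) (36 ^ (k + 11)) (100 ^ (k + 11)) => a b c d le_ab lt_bd.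
have : 9 * a * c <= 25 * b * c by rewrite leq_mul2r le_ab orbT.
lia.
Qed.

Lemma few_large_cubic m n : 160 <= n -> size (large_primes m n) <= 2 ->
  4 * m.+1 ^ 2 < n ^ 3.
Proof.
move=> n_ge few; rewrite ltnNge; apply/negP => le_n3.
have n_ge11 : 11 <= 2 * n by lia.
(* From [n ^ 3 <= 4 * m.+1 ^ 2] and [n >= 160], [m+1] exceeds [6n]. *)
have le56 : 5 * (m + n) <= 6 * m.+1 by nia.
have n_gt5 : 5 < n by lia.
have := few_large_reduced n_gt5 few le56.
rewrite -(leq_exp2r _ _ (isT : 0 < 2)) !expnMn -!expnM ![_ * 2]mulnC !expnM.
rewrite -[8 ^ 2]/64 -[5 ^ 2]/25 -[6 ^ 2]/36 => H.
have E := leq_exp2r (n ^ 3) (4 * m.+1 ^ 2) (_ : 0 < 2 * n - 11).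
have {E}: (n ^ 3) ^ (2 * n - 11) <= (4 * m.+1 ^ 2) ^ (2 * n - 11) by rewrite E //; lia.
rewrite expnMn => K.
have {H K}: 64 ^ n * 25 ^ (n + 11) * (n ^ 3) ^ (2 * n - 11) <=
    4 ^ (2 * n - 11) * (((n ^ 2) ^ 3) ^ n * 36 ^ (n + 11)).
  apply: leq_trans (leq_mul (leqnn _) K) _.
  by rewrite mulnCA leq_mul2l H orbT.
(* 33 is the excess of [6n] over [3 (2n - 11)]. *)
have -> : ((n ^ 2) ^ 3) ^ n = n ^ 33 * (n ^ 3) ^ (2 * n - 11).
  by rewrite -!expnM -expnD; congr (_ ^ _); lia.
have gt0 : 0 < (n ^ 3) ^ (2 * n - 11) by rewrite !expn_gt0; lia.
rewrite mulnAC [X in _ <= X]mulnA [X in _ <= X * _]mulnA.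
rewrite mulnAC [X in _ <= X]mulnAC leq_pmul2r // => H.
have := pow33_ltn n_ge.
rewrite ltnNge => /negP; apply.
have -> : 100 ^ (n + 11) = 4 ^ 11 * 4 ^ n * 25 ^ (n + 11).
  by rewrite (expnMn 4 25 (n + 11) : 100 ^ _ = _) expnD [4 ^ n * _]mulnC.
have gt0' : 0 < 16 ^ n by rewrite expn_gt0.
have E16 : 4 ^ 11 * 4 ^ (2 * n - 11) = 16 ^ n.
  by rewrite -expnD (subnKC n_ge11) expnM.
rewrite -(leq_pmul2l gt0').
have E64 : 64 ^ n = 16 ^ n * 4 ^ n := expnMn 16 4 n.
move: E16 E64 H {le_n3 le56 gt0 gt0' few}.
move: (4 ^ 11) (4 ^ (2 * n - 11)) (16 ^ n) (4 ^ n) (64 ^ n) (25 ^ _) (36 ^ _) (n ^ 33).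
move=> a b _ c _ d e f <- -> H; have := leq_mul (leqnn a) H; lia.
Qed.

Lemma few_large_linear m n : 31 <= n -> n < 160 -> size (large_primes m n) <= 2 ->
  m.+1 < 8 * n.
Proof.
move=> n_ge n_lt few; rewrite ltnNge; apply/negP => le_m.
have le89 : 8 * (m + n) <= 9 * m.+1 by lia.
have n_gt5 : 5 < n by lia.
have H := few_large_reduced n_gt5 few le89.
have {H}: 8 ^ (4 * n) * n ^ (2 * n - 11) <= (9 * n) ^ (n + 11) * n ^ (2 * n - 11).
  have -> : (9 * n) ^ (n + 11) * n ^ (2 * n - 11) = n ^ (3 * n) * 9 ^ (n + 11).
    by rewrite expnMn mulnC mulnCA -expnD mulnC; congr (_ ^ _ * _); lia.
  apply: leq_trans H; have -> : 4 * n = n + (n + 11) + (2 * n - 11) by lia.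
  rewrite !expnD -mulnA -expnMn leq_mul2l; apply/orP; right.
  by rewrite leq_exp2r //; lia.
rewrite leq_pmul2r ?expn_gt0; last by lia.
rewrite expnM -[8 ^ 4]/(4096) => H.
(* Since [a <= 4096], the strict inequality at [n0] persists for larger [n]. Below, 423, 855 and
   1431 are 9 times 47, 95 and 159, the last [n] of each block. *)
have block a n0 : a <= 4096 -> a ^ (n0 + 11) < 4096 ^ n0 -> n0 <= n -> 9 * n <= a -> False.
  move=> a_le base le_n0 le_a.
  have: a ^ (n + 11) < 4096 ^ n.
    rewrite -(subnKC le_n0) addnAC.
    elim: (n - n0) => [|k IH]; first by rewrite !addn0.
    rewrite (addnS (n0 + 11) k) (addnS n0 k) [a ^ _]expnSr [4096 ^ _]expnSr.
    by apply: leq_ltn_trans (leq_mul (leqnn _) a_le) _; rewrite ltn_pmul2r.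
  rewrite ltnNge => /negP; apply; apply: leq_trans H _.
  by rewrite leq_exp2r //; lia.
have [n_lt48|n_ge48] := ltnP n 48; first by apply: (block 423 31); lia.
have [n_lt96|n_ge96] := ltnP n 96; first by apply: (block 855 48); lia.
by apply: (block 1431 96); lia.
Qed.

(** As [k <= n], the quotient [(m+1)^n / (m+n)^k] does not decrease with [m], so for each [n] the
    contradiction is computed at [m = 172] only. *)
Lemma few_large_small m n : 9 <= n -> n < 31 -> size (large_primes m n) <= 2 -> m < 172.
Proof.
move=> n_ge n_lt few; rewrite ltnNge; apply/negP => le_m.
have n_gt0 : 0 < n by lia.
have H := few_large_pow_leq n_gt0 few; set k := (n + 11) %/ 3 in H.
have le_kn : k <= n by lia.
have check : n`! * (172 + n) ^ k < 173 ^ n.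
  have n_mem : n \in iota 9 22 by rewrite mem_iota; lia.
  rewrite /k {H k le_kn n_gt0 few le_m n_ge n_lt}; rewrite /= !inE in n_mem.
  do ?[case/orP: n_mem => [/eqP->|n_mem]]; rewrite ?(eqP n_mem);
    match goal with |- context [?a %/ ?b] =>
      let q := eval vm_compute in (a %/ b) in change (a %/ b) with q end;
    rewrite !factS fact0; lia.
have mono : 173 ^ n * (m + n) ^ k <= m.+1 ^ n * (172 + n) ^ k.
  rewrite -(subnK le_kn) !expnD -!mulnA -!expnMn.
  by apply: leq_mul; rewrite ?leq_exp2r //; nia.
have gt0 : 0 < (m + n) ^ k by rewrite expn_gt0; lia.
rewrite -(ltn_pmul2r gt0) ltnNge in check; case/negP: check.
apply: leq_trans mono _; rewrite mulnAC.
by rewrite leq_mul2r H orbT.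
Qed.

(** * Primality tests and the direct search, in binary arithmetic *)

Lemma N_to_nat_mod a b : N.to_nat (a mod b) = N.to_nat a %% N.to_nat b.
Proof.
have [->|b_neq0] := N.eq_dec b 0; first by rewrite modn0; case: a.
have lt_r := N.mod_lt a b b_neq0.
rewrite {2}(N.div_mod a b b_neq0) N2Nat.inj_add N2Nat.inj_mul plusE multE mulnC.
by rewrite modnMDl modn_small //; lia.
Qed.

Definition primes_below_379 : seq N := [::
  2; 3; 5; 7; 11; 13; 17; 19; 23; 29; 31; 37; 41; 43; 47; 53; 59; 61; 67; 71;
  73; 79; 83; 89; 97; 101; 103; 107; 109; 113; 127; 131; 137; 139; 149; 151;
  157; 163; 167; 173; 179; 181; 191; 193; 197; 199; 211; 223; 227; 229; 233;
  239; 241; 251; 257; 263; 269; 271; 277; 281; 283; 293; 307; 311; 313; 317;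
  331; 337; 347; 349; 353; 359; 367; 373]%num.

Lemma primes_below_379E :
  map N.to_nat primes_below_379 = [seq p <- iota 0 379 | prime p].
Proof. by vm_compute. Qed.

(* 143641 = 379 ^ 2 *)
Definition trial_prime (q : N) : bool :=
  [&& (1 <? q)%num, (q <? 143641)%num &
      all (fun d => (q mod d =? 0)%num ==> (q =? d)%num) primes_below_379].

(** Let [p] be the least prime factor of [q]. Either [q < p ^ 2] and [q] is prime, or [p < 379] and
    the test at [p] forces [q = p]. *)
Lemma trial_primeP q : trial_prime q -> prime (N.to_nat q).
Proof.
case/and3P=> /N.ltb_lt q_gt1 /N.ltb_lt q_lt /allP trial.
have q_gt1' : 1 < N.to_nat q by lia.
have q_gt0 : 0 < N.to_nat q by apply: ltnW.
set p := pdiv (N.to_nat q); have pr_p : prime p by apply: pdiv_prime.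
have [/(ltn_pdiv2_prime q_gt0) //|le_pq] := ltnP (N.to_nat q) (p ^ 2).
have p_lt : p < 379 by rewrite -mulnn in le_pq; nia.
have : p \in map N.to_nat primes_below_379.
  by rewrite primes_below_379E mem_filter pr_p mem_iota.
case/mapP=> d d_in p_d; have dq := pdiv_dvd (N.to_nat q); rewrite -/p p_d in dq.
have /implyP := trial d d_in; move=> /(_ _) /N.eqb_eq -> //.
  by rewrite -p_d.
by apply/N.eqb_eq; apply: N2Nat.inj; rewrite N_to_nat_mod; apply/eqP.
Qed.

(** With [r] the remainder, [m + (n - r)] is a multiple of [p], and [r < n] places it among the
    factors. *)
Lemma mem_large_primes m n p :
  prime p -> n < p -> (m + n) %% p < n -> p \in large_primes m n.
Proof.
move=> pr_p lt_np lt_r; rewrite mem_filter lt_np mem_primes pr_p rising_gt0 /=.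
set r := (m + n) %% p in lt_r.
have p_dvd : p %| m + (n - r).
  have -> : m + (n - r) = (m + n) %/ p * p.
    by have := divn_eq (m + n) p; rewrite -/r; lia.
  exact: dvdn_mull.
have i_in : n - r \in index_iota 1 n.+1 by rewrite mem_index_iota; lia.
by rewrite /rising (big_rem _ i_in) /= dvdn_mulr.
Qed.

Lemma next_large_prime m n p : prime p -> n <= m -> m < p -> p <= m + n ->
  p \in large_primes m n.
Proof.
move=> pr_p le_nm lt_mp le_p; apply: mem_large_primes => //; first by lia.
have -> : m + n = m + n - p + 1 * p by lia.
by rewrite addnC modnMDl modn_small; lia.
Qed.

Definition prime_hit (n m p : N) : bool := [&& (n <? p)%num & ((m + n) mod p <? n)%num].

Fixpoint hits_atleast k (n m : N) (l : seq N) : bool :=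
  if k is k'.+1 then
    if l is p :: l' then hits_atleast (if prime_hit n m p then k' else k) n m l'
    else false
  else true.

Lemma hits_atleast_leq k n m l :
  uniq (map N.to_nat l) -> {in map N.to_nat l, forall p, prime p} ->
  hits_atleast k (N.of_nat n) (N.of_nat m) l -> k <= size (large_primes m n).
Proof.
move=> uniq_l pr_l; set hit := prime_hit (N.of_nat n) (N.of_nat m) => hits.
have le_k : k <= count hit l.
  elim: l k hits {uniq_l pr_l} => [|p l IH] [|k] //= /IH.
  by rewrite -/hit; case: (hit p).
apply: leq_trans le_k _; rewrite -size_filter -(size_map N.to_nat).
apply: uniq_leq_size.
  by apply: subseq_uniq uniq_l; apply/map_subseq/filter_subseq.
move=> q /mapP[p]; rewrite mem_filter => /andP[/andP[/N.ltb_lt lt_np /N.ltb_lt lt_r] p_in] ->.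
have E := N_to_nat_mod (N.of_nat m + N.of_nat n) p.
rewrite N2Nat.inj_add !Nat2N.id plusE in E.
apply: mem_large_primes; first by apply/pr_l/map_f.
  by lia.
by rewrite -E; lia.
Qed.

Definition small_pairs : seq (nat * nat) :=
  [seq (n, m) | n <- iota 9 22, m <- iota 9 163].

Lemma small_pairs_check :
  all (fun nm => (nm.1 <= nm.2) ==>
    hits_atleast 3 (N.of_nat nm.1) (N.of_nat nm.2) primes_below_379) small_pairs.
Proof. by vm_compute. Qed.

Lemma large_primes_gt2_small m n : 9 <= n -> n < 31 -> n <= m -> m < 172 ->
  2 < size (large_primes m n).
Proof.
move=> n_ge n_lt le_nm m_lt.
have nm_in : (n, m) \in small_pairs by apply: allpairs_f; rewrite mem_iota; lia.
have /implyP/(_ le_nm) := allP small_pairs_check _ nm_in.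
apply: hits_atleast_leq; rewrite primes_below_379E ?filter_uniq ?iota_uniq //.
by move=> p; rewrite mem_filter => /andP[].
Qed.

(** * Prime gaps for [31 <= n < 4096] *)

(** A sparse selection of primes. It starts below 31 and runs past [2 ^ 17], because
    [4 (m+1)^2 < 4096^3] means [m+1 < 2 ^ 17]. *)
Definition prime_chain : seq N := [::
  29; 47; 53; 59; 73; 83; 89; 103; 109; 113; 131; 137; 139; 157; 163; 167;
  181; 193; 197; 211; 223; 227; 241; 251; 257; 271; 281; 283; 293; 311; 313;
  317; 347; 349; 353; 383; 389; 397; 431; 433; 443; 479; 487; 499; 523; 547;
  557; 587; 613; 619; 661; 683; 691; 743; 769; 773; 829; 859; 863; 929; 967;
  971; 1039; 1087; 1093; 1163; 1223; 1229; 1289; 1291; 1297; 1327; 1381;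
  1439; 1499; 1567; 1637; 1699; 1759; 1831; 1907; 1987; 2069; 2143; 2221;
  2311; 2399; 2477; 2557; 2647; 2741; 2843; 2939; 3041; 3137; 3229; 3343;
  3461; 3571; 3691; 3803; 3931; 4057; 4177; 4297; 4423; 4561; 4703; 4831;
  4973; 5119; 5273; 5431; 5591; 5749; 5903; 6073; 6247; 6421; 6599; 6781;
  6967; 7151; 7333; 7529; 7727; 7933; 8123; 8329; 8543; 8761; 8971; 9199;
  9431; 9649; 9887; 10111; 10357; 10607; 10853; 11093; 11353; 11617; 11867;
  12119; 12391; 12671; 12953; 13241; 13523; 13807; 14107; 14411; 14717;
  15031; 15349; 15671; 15991; 16319; 16657; 16993; 17341; 17683; 18041;
  18401; 18757; 19121; 19489; 19867; 20249; 20639; 21031; 21419; 21821;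
  22229; 22643; 23059; 23473; 23899; 24337; 24767; 25189; 25643; 26099;
  26539; 26993; 27457; 27919; 28403; 28879; 29363; 29863; 30367; 30871;
  31391; 31907; 32429; 32957; 33493; 34039; 34589; 35141; 35677; 36241;
  36809; 37379; 37967; 38561; 39139; 39749; 40361; 40961; 41579; 42209;
  42841; 43481; 44131; 44777; 45439; 46103; 46771; 47441; 48131; 48823;
  49499; 50207; 50923; 51637; 52363; 53101; 53831; 54583; 55343; 56093;
  56857; 57637; 58417; 59197; 59999; 60793; 61609; 62423; 63247; 64081;
  64921; 65761; 66617; 67481; 68329; 69203; 70079; 70969; 71867; 72767;
  73681; 74611; 75533; 76471; 77419; 78367; 79319; 80287; 81239; 82231;
  83231; 84211; 85223; 86243; 87257; 88289; 89329; 90379; 91433; 92489;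
  93563; 94651; 95731; 96827; 97943; 99053; 100169; 101293; 102437; 103591;
  104743; 105913; 107089; 108271; 109453; 110651; 111869; 113083; 114299;
  115523; 116747; 117991; 119243; 120511; 121789; 123083; 124367; 125683;
  126989; 128321; 129643; 130987; 132347; 133709; 135077]%num.

(* Let p <= m, let g be the distance from p to the third prime after it in the
   chain, and suppose n < g. The first clause then rules out m + 1 < 8 n when
   31 <= n < 160, and the second one rules out 4 (m+1)^2 < n^3 when 160 <= n. *)
Definition gap_ok (p g : N) : bool :=
  [|| (1280 <=? p)%num, (g <=? 31)%num | (8 * (g - 1) <=? p + 1)%num] &&
  ((g <=? 160)%num || ((g - 1) * (g - 1) * (g - 1) <=? 4 * ((p + 1) * (p + 1)))%num).

Fixpoint gaps_ok (l : seq N) : bool :=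
  if l is p0 :: ((p1 :: p2 :: p3 :: _) as l') then
    [&& (p0 <? p1)%num, (p1 <? p2)%num, (p2 <? p3)%num, gap_ok p0 (p3 - p0)%num & gaps_ok l']
  else true.

Lemma prime_chain_primes : all trial_prime prime_chain.
Proof. by vm_compute. Qed.

Lemma prime_chain_gaps : gaps_ok prime_chain.
Proof. by vm_compute. Qed.

(** [p0] is the last entry up to [m]; keeping [m] below the third entry from the end leaves room for
    three successors. *)
Lemma gaps_okP l (m : N) : gaps_ok l -> (head 0 l <= m)%num -> (m < nth 0 l (size l - 3)%N)%num ->
  exists p0 p1 p2 p3 : N,
    [/\ p1 \in l, p2 \in l, p3 \in l, gap_ok p0 (p3 - p0)%num &
        (p0 <= m /\ m < p1 /\ p1 < p2 /\ p2 < p3)%num].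
Proof.
elim: l => [|p0 [|p1 [|p2 [|p3 l]]] IH]; try by move=> /= _ ? ?; lia.
move=> /= /and5P[/N.ltb_lt lt01 /N.ltb_lt lt12 /N.ltb_lt lt23 gap ok] le_p0 lt_m.
have [lt|ge] := N.lt_ge_cases m p1.
  by exists p0, p1, p2, p3; rewrite !inE !eqxx ?orbT.
have lt_m' : (m < nth 0 [:: p1, p2, p3 & l] (size [:: p1, p2, p3 & l] - 3)%N)%num.
  by move: lt_m; rewrite /= !subSS subn0.
have [a [b [c [d [b_in c_in d_in gap' ineqs]]]]] := IH ok ge lt_m'.
by exists a, b, c, d; rewrite in_cons b_in in_cons c_in in_cons d_in !orbT.
Qed.

Lemma large_primes_gt2_medium m n : 31 <= n -> n < 4096 -> n <= m -> 2 < size (large_primes m n).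
Proof.
move=> n_ge n_lt le_nm; rewrite ltnNge; apply/negP => few.
have lin : n < 160 -> m.+1 < 8 * n by move=> ?; apply: few_large_linear few.
have cub : 160 <= n -> 4 * m.+1 ^ 2 < n ^ 3 by move=> ?; apply: few_large_cubic few.
have cub' : 160 <= n -> 4 * (m.+1 * m.+1) < n * n * n.
  by move/cub; rewrite !expnS !expn0 !muln1; lia.
have [|||p0 [p1 [p2 [p3 [in1 in2 in3 gap ineqs]]]]] := @gaps_okP prime_chain (N.of_nat m).
- exact: prime_chain_gaps.
- by rewrite /=; lia.
- have -> : nth 0%num prime_chain (size prime_chain - 3) = 132347%num by vm_compute.
  by have [/lin|/cub'] := ltnP n 160; nia.
have le_p3 : N.to_nat p3 <= m + n.
  case/andP: gap => g1 g2; have [n_lt160|n_ge160] := ltnP n 160.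
    (* [m+1 < 8 * 160 = 1280] excludes the first alternative; under the third, [n < p3 - p0] would
       give [8n <= m+1]. *)
    have := lin n_lt160; case/or3P: g1 => /N.leb_le; lia.
  case/orP: g2 => /N.leb_le g2; first by lia.
  rewrite leqNgt; apply/negP => lt_p3; have := cub' n_ge160; rewrite ltnNge => /negP; apply.
  have le_n : n <= N.to_nat (p3 - p0 - 1) by lia.
  have le_p0 : N.to_nat (p0 + 1) <= m.+1 by lia.
  have := leq_mul (leq_mul le_n le_n) le_n; have := leq_mul le_p0 le_p0.
  lia.
have mem_p p : p \in prime_chain -> (N.of_nat m < p)%num -> (p <= p3)%num ->
    N.to_nat p \in large_primes m n.
  move=> p_in lt_mp le_pp3; apply: next_large_prime => //; try lia.
  by apply: trial_primeP; apply: (allP prime_chain_primes).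
have : size [:: N.to_nat p1; N.to_nat p2; N.to_nat p3] <= size (large_primes m n).
  apply: uniq_leq_size; first by rewrite /= !inE; lia.
  by move=> p; rewrite !inE => /or3P[] /eqP ->; apply: mem_p => //; lia.
by rewrite leqNgt => /negP; apply.
Qed.

(** * The range [n >= 4096] *)

(** [n <= (25/21) j s] and [j^3 <= (50/23) s] give [n^3 < 3.67 s^4], while [m >= (30/31) s^2] gives
    [4 m^2 > 3.74 s^4]. *)
Lemma quartic_contradiction (n m s j : Z) :
  (0 <= n -> 9 <= j -> 340 <= s -> s * s <= m + n -> 4 * (m * m) <= n * n * n ->
   7 * n <= 8 * j * (s + 14) -> 23 * (j * j * j) <= 50 * s -> False)%Z.
Proof.
move=> n0 j9 s340 le_s le_m le_n le_j.
(* The summand 14 is absorbed because [24 * 14 = 336 <= s]. *)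
have h1 : (21 * n <= 25 * (j * s))%Z by nia.
have h2 : (1863 * j <= 50 * s)%Z by nia.
have h3 : (31 * n <= s * s)%Z by nia.
have h4 : (30 * (s * s) <= 31 * m)%Z by lia.
have h5 : ((30 * (s * s)) * (30 * (s * s)) <= (31 * m) * (31 * m))%Z.
  apply: Z.mul_le_mono_nonneg; lia.
have h6 : ((21 * n) * (21 * n) <= 25 * (j * s) * (25 * (j * s)))%Z.
  apply: Z.mul_le_mono_nonneg; lia.
have h7 : ((21 * n) * (21 * n) * (21 * n) <= 25 * (j * s) * (25 * (j * s)) * (25 * (j * s)))%Z.
  apply: Z.mul_le_mono_nonneg; nia.
have h8 : (23 * (j * j * j) * (s * s * s) <= 50 * s * (s * s * s))%Z.
  apply: Z.mul_le_mono_nonneg_r; nia.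
have h9 : (0 < s * s * s * s)%Z by nia.
nia.
Qed.

Lemma sqrt_exists N : exists s, s * s <= N < s.+1 * s.+1.
Proof.
elim: N => [|N [s /andP[le_s lt_s]]]; first by exists 0.
have [lt|ge] := ltnP N.+1 (s.+1 * s.+1); first by exists s; lia.
by exists s.+1; apply/andP; split => //; nia.
Qed.

Lemma pow2_cube i : 9 <= i -> 23 * i.+1 ^ 3 <= 50 * 2 ^ i.
Proof.
elim: i => // i IH; rewrite leq_eqVlt => /predU1P[<-|lt_i]; first by lia.
have {}IH := IH lt_i; rewrite [2 ^ _]expnS [X in _ <= X]mulnCA.
apply: leq_trans (_ : 2 * (23 * i.+1 ^ 3) <= _); last by rewrite leq_mul2l IH orbT.
rewrite [X in _ <= X]mulnCA leq_mul2l /= !expnS !expn0 !muln1; nia.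
Qed.

Lemma large_primes_gt2_big m n : 4096 <= n -> n <= m -> 2 < size (large_primes m n).
Proof.
move=> n_ge le_nm; rewrite ltnNge; apply/negP => few.
have n_gt0 : 0 < n by lia.
have cub : 4 * m.+1 ^ 2 < n ^ 3 by apply: few_large_cubic few; lia.
have [s /andP[le_s lt_s]] := sqrt_exists (m + n).
have main := few_large_pow27_leq n_gt0 le_nm lt_s few.
have s_gt0 : 0 < s by lia.
have [le_i lt_i] := (trunc_logP (isT : 1 < 2) s_gt0, trunc_log_ltn s (isT : 1 < 2)).
(* [j] is the bit length of [s], so [s + 1 <= 2 ^ j]. *)
set i := trunc_log 2 s in le_i lt_i; set j := i.+1 in lt_i.
have le_N : m + n <= 2 ^ (2 * j).
  by rewrite mulnC expnM -mulnn; apply: leq_trans (ltnW lt_s) (leq_mul _ _).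
(* The fourth power of [main] brings in [2 ^ 19 <= 27 ^ 4]; against [8 ^ (4 * n) = 2 ^ (12 * n)]
   this leaves [2 ^ (7 * n)]. *)
have le_n : 7 * n <= 8 * j * (s + 14).
  rewrite -(leq_exp2l (m := 2)) //.
  have gt0 : 0 < 8 ^ (4 * n) by rewrite expn_gt0.
  rewrite -(leq_pmul2l gt0).
  have -> : 8 ^ (4 * n) * 2 ^ (7 * n) = (2 ^ 19) ^ n.
    by rewrite -[8 ^ _](expnM 2 3) -!expnM -expnD; congr (2 ^ _); lia.
  have c27 : 2 ^ 19 <= 27 ^ 4 by lia.
  apply: leq_trans (_ : (27 ^ 4) ^ n <= _); first by rewrite leq_exp2r.
  rewrite -expnM mulnC expnM.
  apply: leq_trans (_ : (8 ^ n * (m + n) ^ (s + 14)) ^ 4 <= _); first by rewrite leq_exp2r.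
  rewrite expnMn -!expnM [n * 4]mulnC leq_mul2l; apply/orP; right.
  have -> : 8 * j * (s + 14) = 2 * j * ((s + 14) * 4) by lia.
  have e_gt0 : 0 < (s + 14) * 4 by rewrite muln_gt0 addn_gt0 orbT.
  by rewrite [2 ^ _]expnM leq_exp2r.
clear main lt_s le_N few.
(* If [s < 340] then [j <= 9], and [8 * 9 * 353 = 25416] is less than [7 * 4096 = 28672]. *)
have s_ge : 340 <= s.
  rewrite leqNgt; apply/negP => lt_s340.
  have i_lt9 : i < 9.
    by rewrite -(ltn_exp2l (m := 2)) //; apply: leq_ltn_trans le_i _; lia.
  have : 8 * j * (s + 14) <= 8 * 9 * 353 by rewrite leq_mul //; lia.
  by move/(leq_trans le_n); lia.
have i_ge : 8 <= i.
  by rewrite -ltnS -(ltn_exp2l (m := 2)) //; apply: leq_ltn_trans lt_i; lia.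
have le_j : 23 * j ^ 3 <= 50 * s.
  (* The power of 2 is too small at [i = 8]; there [s >= 340] suffices, since
     [23 * 9 ^ 3 = 16767 <= 50 * 340]. *)
  have [lt_i9|ge_i9] := ltnP i 9; first by rewrite /j (_ : i = 8); lia.
  by apply: leq_trans (pow2_cube ge_i9) _; rewrite leq_mul2l le_i orbT.
apply: (@quartic_contradiction (Z.of_nat n) (Z.of_nat m) (Z.of_nat s) (Z.of_nat j)); nia.
Qed.

(** * Assembly of the three ranges of [n] *)

Theorem theorem3 (n m : nat) (hn : 9 <= n) (hm : n <= m) :
  exists p q r : nat,
    [/\ [/\ prime p, prime q & prime r],
        [/\ p != q, p != r & q != r],
        [/\ n < p, n < q & n < r] &
        [/\ p %| \prod_(1 <= i < n.+1) (m + i),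
            q %| \prod_(1 <= i < n.+1) (m + i) &
            r %| \prod_(1 <= i < n.+1) (m + i)]].
Proof.
have size_gt2 : 2 < size (large_primes m n).
  have [n_lt31|n_ge31] := ltnP n 31.
    rewrite ltnNge; apply/negP => few; have m_lt := few_large_small hn n_lt31 few.
    by have := large_primes_gt2_small hn n_lt31 hm m_lt; rewrite ltnNge few.
  have [n_lt|n_ge] := ltnP n 4096; first exact: large_primes_gt2_medium.
  exact: large_primes_gt2_big.
have uniq_l : uniq (large_primes m n) by rewrite filter_uniq ?primes_uniq.
have mem_l i : i < 3 -> nth 0 (large_primes m n) i \in large_primes m n.
  by move=> lt_i3; apply: mem_nth; apply: leq_trans size_gt2.
have large p : p \in large_primes m n -> [/\ prime p, n < p & p %| rising m n].
  by rewrite mem_filter mem_primes => /andP[-> /and3P[-> _ ->]].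
have [pr0 lt0 dvd0] := large _ (mem_l 0 isT).
have [pr1 lt1 dvd1] := large _ (mem_l 1 isT).
have [pr2 lt2 dvd2] := large _ (mem_l 2 isT).
exists (nth 0 (large_primes m n) 0), (nth 0 (large_primes m n) 1).
exists (nth 0 (large_primes m n) 2).
by split; split; rewrite ?nth_uniq //; apply: leq_trans size_gt2.
Qed.
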